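(* Let $n,d\ge 1$ and let $F$ be a real-valued function of the $n$-particle measures $\frac1n\sum_{i=1}^n\delta_{w_i}$, $w_i\in\mathbb{R}^d$. Assume that $F$ is $\ell$-smooth and that it has a minimizer $\widehat\mu$ among all $n$-particle measures. Let $w_1^{(0)},\dots,w_n^{(0)}\in\mathbb{R}^d$ be pairwise distinct, let $\gamma>0$, and let the particle gradient descent iterates be $$w_i^{(k+1)}=w_i^{(k)}-\gamma\,\partial_{w_i}F(\mu_k),\qquad \mu_k=\frac1n\sum_{i=1}^n\delta_{w_i^{(k)}},\qquad k\ge 0 .$$ Then for every $k$: (a) If $F$ is $\lambda$-displacement convex with $\lambda>0$ and $\gamma\le 2/(\lambda+\ell)$, then $$F(\mu_{k+1})-F(\widehat\mu)\le \ell\left(1-\frac{2\lambda\ell\gamma}{\ell+\lambda}\right)^k W_2^2(\mu_0,\widehat\mu).$$ (b) If $F$ is $0$-displacement convex and $\gamma\le 1/\ell$, then $$F(\mu_{k+1})-F(\widehat\mu)\le \frac{2\,(F(\mu_0)-F(\widehat\mu))\,W_2^2(\mu_0,\widehat\mu)}{2W_2^2(\mu_0,\widehat\mu)+(F(\mu_0)-F(\widehat\mu))\,\gamma k}.$$ (c) If $F$ is star displacement convex, $\max_{m\in\{1,\dots,k\}}W_2^2(\mu_m,\widehat\mu)\le r^2$, and $\gamma\le 1/\ell$, then $$F(\mu_{k+1})-F(\widehat\mu)\le \frac{2\,(F(\mu_0)-F(\widehat\mu))\,r^2}{2r^2+(F(\mu_0)-F(\widehat\mu))\,\gamma k}.$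$
   Context: An $n$-particle measure is $\frac1n\sum_{i=1}^n\delta_{w_i}$ with $w_i\in\mathbb{R}^d$ ($\delta_w$ is the Dirac measure at $w$). $\partial_{w_i}F(\mu)$ is the gradient in $w_i$ of the map $(w_1,\dots,w_n)\mapsto F(\frac1n\sum_i\delta_{w_i})$. $\ell$-smooth: this map $\mathbb{R}^{nd}\to\mathbb{R}$ is differentiable with $\ell$-Lipschitz gradient in the Euclidean norm. For $\mu=\frac1n\sum_i\delta_{w_i}$ and $\nu=\frac1n\sum_i\delta_{v_i}$, an optimal permutation $\sigma^*$ is a minimizer of $\sum_{i}\|w_i-v_{\sigma(i)}\|^2$ over all permutations $\sigma$ of $\{1,\dots,n\}$. The optimal transport from $\mu$ to $\nu$ is $T(w_i)=v_{\sigma^*(i)}$. The squared Wasserstein distance is normalized without the factor $1/n$: $W_2^2(\mu,\nu)=\sum_{i}\|w_i-v_{\sigma^*(i)}\|^2$. The displacement interpolation is $\mu_t=\frac1n\sum_i\delta_{(1-t)w_i+t v_{\sigma^*(i)}}$, $t\in[0,1]$. (The notation $\mu_t$ here is unrelated to the iterates $\mu_k$.) $F$ is $\lambda$-displacement convex if for all $n$-particle $\mu,\nu$ and all $t\in[0,1]$, along the displacement interpolation, $$F(\mu_t)\le(1-t)F(\mu)+tF(\nu)-\frac{\lambda}{2}\,t(1-t)\,W_2^2(\mu,\nu).$$ $F$ is star displacement convex if, for the minimizer $\widehat\mu$ of $F$ over $n$-particle measures, every $n$-particle $\mu=\frac1n\sum_i\delta_{w_i}$ satisfies $$\sum_{i=1}^n\langle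 w_i-T(w_i),\partial_{w_i}F(\mu)\rangle\ge F(\mu)-F(\widehat\mu),$$ where $T$ is the optimal transport from $\mu$ to $\widehat\mu$. *)

(* Defs.v *)
From HB Require Import structures.
From mathcomp Require Import all_boot all_order all_algebra fingroup perm.
From mathcomp Require Import all_classical all_reals all_analysis.

Set Implicit Arguments.
Unset Strict Implicit.
Unset Printing Implicit Defensive.

Import Order.TTheory GRing.Theory Num.Theory.
Import numFieldNormedType.Exports.

Local Open Scope classical_set_scope.
Local Open Scope ring_scope.

(* The library's norm on matrices is the sup norm, hence these Euclidean
   versions; they are used on both R^d = 'rV_d and R^(nd) = 'M_(n, d). *)
Section Euclidean.
Context {R : realType} {m p : nat}.
Implicit Types A B : 'M[R]_(m, p).

Definition dot A B : R := \sum_(i < m) \sum_(j < p) A i j * B i j.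

Definition enorm A : R := Num.sqrt (dot A A).

End Euclidean.

(* R^d with its Borel sigma-algebra. *)
Definition borelRd (R : realType) (d : nat) :=
  g_sigma_algebraType (@open 'rV[R]_d).

(* Particle positions (w_1, ..., w_n) are the rows of w : 'M[R]_(n, d). *)
Section Empirical.
Local Open Scope ereal_scope.
Context {R : realType} {n d : nat}.
Variable w : 'M[R]_(n, d).

Definition empirical (A : set (borelRd R d)) : \bar R :=
  (n%:R^-1)%R%:E * \sum_(i < n) \d_(row i w : borelRd R d) A.

Let empirical_msumE : empirical =
  mscale ((n%:R^-1)%:nng)%R
    (msum (fun k => \d_(nth 0%R [seq row i w | i <- enum 'I_n] k : borelRd R d)) n).
Proof.
apply/funext => A; rewrite /empirical /mscale /msum /=; congr (_ * _).
apply: eq_bigr => i _.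
by rewrite (nth_map i) ?size_enum_ord // nth_ord_enum.
Qed.

Let empirical0 : empirical set0 = 0.
Proof. by rewrite empirical_msumE measure0. Qed.

Let empirical_ge0 A : 0 <= empirical A.
Proof. by rewrite empirical_msumE measure_ge0. Qed.

Let empirical_semi_sigma_additive : semi_sigma_additive empirical.
Proof. by rewrite empirical_msumE; exact: measure_semi_sigma_additive. Qed.

HB.instance Definition _ := isMeasure.Build _ _ _ empirical
  empirical0 empirical_ge0 empirical_semi_sigma_additive.

End Empirical.

Definition particle_measure (R : realType) (n d : nat) : Type :=
  {mu : {measure set (borelRd R d) -> \bar R}
      | exists w : 'M[R]_(n, d), mu = empirical w}.

Definition particles {R : realType} {n d : nat} (w : 'M[R]_(n, d)) :
    particle_measure R n d :=
  exist _ (empirical w : {measure set (borelRd R d) -> \bar R})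
    (ex_intro _ w erefl).

Section Transport.
Context {R : realType} {n d : nat}.
Implicit Types (w v : 'M[R]_(n, d)) (s : 'S_n).

Definition transport_cost w v s : R :=
  \sum_(i < n) enorm (row i w - row (s i) v) ^+ 2.

Definition optimal_perm w v s : Prop :=
  forall s', transport_cost w v s <= transport_cost w v s'.

(* The squared Wasserstein distance, without the factor 1/n. *)
Definition W2sq w v : R :=
  transport_cost w v [arg min_(s < 1%g) transport_cost w v s]%O.

Definition interpolation w v s (t : R) : 'M[R]_(n, d) :=
  \matrix_(i < n) ((1 - t) *: row i w + t *: row (s i) v).

End Transport.

Section Functionals.
Context {R : realType} {n d : nat}.
Variable F : particle_measure R n d -> R.
Implicit Types w v : 'M[R]_(n, d).

Definition particle_fun w : R := F (particles w).

Definition particle_grad (i : 'I_n) w : 'rV[R]_d :=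
  \row_(j < d) 'D_(delta_mx i j) particle_fun w.

Definition full_grad w : 'M[R]_(n, d) := \matrix_(i < n) particle_grad i w.

Definition smooth (l : R) : Prop :=
  (forall w, differentiable particle_fun w) /\
  (forall w v, enorm (full_grad w - full_grad v) <= l * enorm (w - v)).

(* The optimal permutation s need not be unique. In the next two definitions
   the inequality is asked for one optimal s only, independent of t; as these
   are hypotheses, this covers any rule for selecting s. *)
Definition displacement_convex (lambda : R) : Prop :=
  forall w v, exists2 s, optimal_perm w v s &
    forall t : R, 0 <= t <= 1 ->
      F (particles (interpolation w v s t)) <=
        (1 - t) * F (particles w) + t * F (particles v)
        - lambda / 2 * t * (1 - t) * W2sq w v.

Definition is_minimizer (mu : particle_measure R n d) : Prop :=
  forall nu, F mu <= F nu.

(* Here v lists the particles of the minimizer. *)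
Definition star_displacement_convex v : Prop :=
  forall w, exists2 s, optimal_perm w v s &
    F (particles w) - F (particles v) <=
      \sum_(i < n) dot (row i w - row (s i) v) (particle_grad i w).

End Functionals.

(* Main.v *)
(* On [R^(nd)] particle gradient descent is ordinary gradient descent for the
   permutation invariant function [f w = F (particles w)], which is l-smooth and
   whose gradient vanishes at every relabelling of the minimizer.  Besides
   descent, parts (b) and (c) only need
     f w - f v <= <w - v_s, grad f w>,
   where s is an optimal permutation and v_s is v relabelled by s; displacement
   convexity gives this by differentiating the interpolation at t = 0.

   Part (a) needs the stronger inequality
     |grad f w|^2 + lambda l |w - v_s|^2 <= (l + lambda) <grad f w, w - v_s>,
   although f is not convex.  Near a configuration of distinct particles the
   optimal permutation is the identity, so f is lambda-convex there and the
   inequality holds between nearby points.  If w and v both have distinct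
   particles, monotonicity of optimal transport keeps the particles uniformly
   apart along the segment from w to v_s, so the segment can be cut into short
   pieces and the inequality added up.  The general case follows by perturbing w
   and v and using that there are finitely many permutations; hence collisions
   of the iterates are harmless. *)
Require Import Defs.
From mathcomp Require Import all_boot all_order all_algebra fingroup perm.
From mathcomp Require Import all_classical all_reals all_analysis.
From mathcomp Require Import ring lra.

Import Order.TTheory GRing.Theory Num.Theory.
Import numFieldNormedType.Exports.

Local Open Scope ring_scope.

Set Implicit Arguments.
Unset Strict Implicit.
Unset Printing Implicit Defensive.

(** * Euclidean inner product on matrices *)

Section Dot.
Context {R : realType} {m p : nat}.
Implicit Types A B C : 'M[R]_(m, p).

Lemma dotC A B : dot A B = dot B A.
Proof. by do 2![apply: eq_bigr => ? _]; rewrite mulrC. Qed.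

Lemma dotDl A B C : dot (A + B) C = dot A C + dot B C.
Proof.
rewrite /dot -big_split; apply: eq_bigr => i _; rewrite -big_split.
by apply: eq_bigr => j _; rewrite mxE mulrDl.
Qed.

Lemma dotZl (a : R) A B : dot (a *: A) B = a * dot A B.
Proof.
rewrite /dot mulr_sumr; apply: eq_bigr => i _; rewrite mulr_sumr.
by apply: eq_bigr => j _; rewrite mxE mulrA.
Qed.

Lemma dotNl A B : dot (- A) B = - dot A B.
Proof. by rewrite -scaleN1r dotZl mulN1r. Qed.

Lemma dot0l A : dot 0 A = 0.
Proof. by rewrite -(scale0r A) dotZl mul0r. Qed.

Lemma dotDr A B C : dot C (A + B) = dot C A + dot C B.
Proof. by rewrite dotC dotDl !(dotC C). Qed.

Lemma dotZr (a : R) A B : dot A (a *: B) = a * dot A B.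
Proof. by rewrite dotC dotZl dotC. Qed.

Lemma dotNr A B : dot A (- B) = - dot A B.
Proof. by rewrite dotC dotNl dotC. Qed.

Definition dotE := (dotDl, dotDr, dotNl, dotNr, dotZl, dotZr).

Lemma dot_ge0 A : 0 <= dot A A.
Proof. by do 2![apply: sumr_ge0 => ? _]; rewrite -expr2 sqr_ge0. Qed.

Lemma sqr_coef_le_dot A i j : A i j ^+ 2 <= dot A A.
Proof.
have sq k q : 0 <= A k q * A k q by rewrite -expr2 sqr_ge0.
rewrite /dot (bigD1 i) //= (bigD1 j) //= expr2 -addrA lerDl addr_ge0 //.
  by apply: sumr_ge0.
by apply: sumr_ge0 => ? _; apply: sumr_ge0.
Qed.

Lemma dot_eq0 A : dot A A = 0 -> A = 0.
Proof.
move=> A0; apply/matrixP => i j; apply/eqP; rewrite mxE -sqrf_eq0.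
by rewrite eq_le sqr_ge0 andbT -A0 sqr_coef_le_dot.
Qed.

Lemma dot_CauchySchwarz A B : dot A B ^+ 2 <= dot A A * dot B B.
Proof.
have := dot_ge0 B; rewrite le_eqVlt => /predU1P[/esym B0|B_gt0].
  by rewrite B0 (dot_eq0 B0) dotC dot0l expr0n mulr0.
have := dot_ge0 (dot B B *: A - dot A B *: B).
rewrite !dotE (dotC B A) => h.
rewrite -(ler_pM2l B_gt0); nra.
Qed.

Lemma sqr_enorm A : enorm A ^+ 2 = dot A A.
Proof. by rewrite sqr_sqrtr ?dot_ge0. Qed.

Lemma enorm_ge0 A : 0 <= enorm A.
Proof. exact: sqrtr_ge0. Qed.

Lemma normr_dot_le A B : `|dot A B| <= enorm A * enorm B.
Proof.
rewrite -sqrtr_sqr -sqrtrM ?dot_ge0 //.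
by rewrite ler_wsqrtr ?dot_CauchySchwarz.
Qed.

End Dot.

(** * One-variable calculus and the scalar recurrence for the sublinear rates *)

Section RealFunctions.
Context {R : realType}.

Lemma lipschitz_continuous (h : R -> R) (K : R) :
  (forall s t, `|h s - h t| <= K * `|s - t|) -> continuous h.
Proof.
move=> hK t; apply/cvgrPdist_lt => e e_gt0; near=> s.
have K1_gt0 : 0 < `|K| + 1 by rewrite ltr_wpDl.
apply: (le_lt_trans (hK _ _)).
apply: (@le_lt_trans _ _ ((`|K| + 1) * `|t - s|)).
  by rewrite ler_wpM2r // (le_trans (ler_norm K)) // lerDl.
rewrite -ltr_pdivlMl //.
by near: s; apply: cvgr_dist_lt; rewrite // mulr_gt0 ?invr_gt0.
Unshelve. all: by end_near. Qed.

Lemma continuous_dot (m p : nat) (A B : R -> 'M[R]_(m, p)) (x : R) :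
  (forall i j, {for x, continuous (fun t => A t i j)}) ->
  (forall i j, {for x, continuous (fun t => B t i j)}) ->
  {for x, continuous (fun t => dot (A t) (B t))}.
Proof.
move=> cA cB; apply: cvg_big => [|i _]; first exact: add_continuous.
apply: cvg_big => [|j _]; first exact: add_continuous.
by apply: cvgM; [exact: cA|exact: cB].
Qed.

Lemma continuous_line (m p : nat) (x u : 'M[R]_(m, p)) i j :
  continuous (fun t : R => (x + t *: u) i j).
Proof.
apply: (@lipschitz_continuous _ `|u i j|) => s t.
rewrite !mxE [X in `|X|](_ : _ = u i j * (s - t)) ?normrM //; ring.
Qed.

Lemma near_lt0 (h : R -> R) : {for 0, continuous h} -> h 0 < 0 ->
  \forall t \near dnbhs (0 : R), h t < 0.
Proof. by move=> /cvgr_lt hc /hc; exact: nbhs_dnbhs. Qed.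

Lemma taylor1_upper (phi dphi : R -> R) (K : R) :
    (forall t : R, is_derive t 1 phi (dphi t)) ->
    (forall t, 0 <= t -> dphi t - dphi 0 <= K * t) ->
  phi 1 - phi 0 - dphi 0 <= K / 2.
Proof.
move=> phiD dphiK.
pose psi t := phi t - (t * dphi 0 + K / 2 * t ^+ 2).
have psiD (t : R) : is_derive t 1 psi (dphi t - (dphi 0 + K * t)).
  apply: is_derive_eq; rewrite /GRing.scale /=; lra.
have psi_cont : {within `[0, 1], continuous psi}%classic.
  apply: continuous_subspaceT => t.
  by apply/differentiable_continuous/derivable1_diffP; have [] := psiD t.
have [c] := MVT ltr01 (fun t _ => psiD t) psi_cont.
rewrite in_itv /= => /andP[c_gt0 _] psi01.
have := dphiK c (ltW c_gt0); move: psi01; rewrite /psi; lra.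
Qed.

Lemma taylor1_dist (phi dphi : R -> R) (K : R) :
    (forall t : R, is_derive t 1 phi (dphi t)) ->
    (forall t, 0 <= t -> `|dphi t - dphi 0| <= K * t) ->
  `|phi 1 - phi 0 - dphi 0| <= K / 2.
Proof.
move=> phiD dphiK; rewrite ler_norml; apply/andP; split; last first.
  by apply: (taylor1_upper phiD) => t /dphiK /ler_normlP[].
have h : - phi 1 - - phi 0 - - dphi 0 <= K / 2.
  apply: (@taylor1_upper (\- phi) (\- dphi)).
  by move=> t t_ge0; case/ler_normlP: (dphiK t t_ge0) => /=; lra.
lra.
Qed.

(* The rate of (b) and (c): [e_{m+1} <= e_m - gamma e_m^2 / (2 D)] makes
   [1 / e_m] grow by at least [gamma / (2 D)] per step. *)
Lemma sublinear_rate (e : nat -> R) (D gamma : R) (k : nat) :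
    0 < gamma -> 0 <= D -> (D = 0 -> (0 < k)%N \/ e 0%N = 0) ->
    (forall m, 0 <= e m) -> (forall m, e m.+1 <= e m) ->
    (forall m, (1 <= m <= k)%N -> gamma * e m ^+ 2 <= 2 * D * (e m - e m.+1)) ->
  e k.+1 <= 2 * e 0%N * D / (2 * D + e 0%N * gamma * k%:R).
Proof.
move=> g0 D_ge0 D0 e_ge0 e_dec rec.
have e_antimono m q : (m <= q)%N -> e q <= e m.
  by move: m q; apply/nonincreasing_seqP.
(* For [D = 0] the right-hand side is [0], even over a zero denominator since [x / 0 = 0]; so the
   error has to vanish by index [k.+1]. *)
have [D_eq0|D_neq0] := eqVneq D 0.
  rewrite D_eq0 !(mulr0, mul0r); have [k_gt0|e00] := D0 D_eq0; last first.
    by rewrite -e00 e_antimono.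
  have := rec 1%N; rewrite k_gt0 D_eq0 mulr0 mul0r pmulr_rle0 // => /(_ isT) e1.
  have /eqP e10 : e 1%N == 0 by rewrite -sqrf_eq0 eq_le e1 sqr_ge0.
  by rewrite -e10 e_antimono.
have D_gt0 : 0 < D by rewrite lt_neqAle eq_sym D_neq0.
have den m : 0 < 2 * D + e 0%N * gamma * m%:R.
  by rewrite ltr_wpDr ?mulr_gt0 // !mulr_ge0 // ltW.
rewrite ler_pdivlMr //.
suff h j : (j <= k)%N ->
    e j.+1 * (2 * D + e 0%N * gamma * j%:R) <= 2 * e 0%N * D.
  exact: h.
elim: j => [_|j IH jk].
  rewrite mulr0 addr0; have := e_dec 0%N; nra.
have {}IH := IH (ltnW jk); have {rec} := rec j.+1 jk.
have := e_dec j.+1; have := e_ge0 j.+2; have e0 := e_ge0 0%N.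
have := e_ge0 j.+1; rewrite le_eqVlt => /predU1P[<- + + _|].
  move=> h1 h2; have -> : e j.+2 = 0 by lra.
  by rewrite mul0r !mulr_ge0.
rewrite -[j.+1%:R]natr1.
move: (e j.+1) (e j.+2) (e 0%N) (j%:R : R) e0 IH => a b c q c0 IH a0 b0 ba r.
rewrite -(ler_pM2l a0).
(* As [b <= a], [a ^+ 2] weakens to [a * b]; [c] times this plus [b] times [IH] is the goal
   multiplied by [a]. *)
have r1 : gamma * a * b <= 2 * D * (a - b).
  apply: le_trans r; rewrite -mulrA ler_pM2l // expr2 ler_pM2l //.
have := ler_wpM2l b0 IH; have := ler_wpM2l c0 r1; lra.
Qed.

End RealFunctions.

(** * Optimal relabellings and permutation invariance *)

Section Transport.
Context {R : realType} {n d : nat}.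
Implicit Types (w v : 'M[R]_(n, d)) (s : 'S_n).

Lemma dot_rows w v : dot w v = \sum_(i < n) dot (row i w) (row i v).
Proof.
apply: eq_bigr => i _; rewrite /dot big_ord1.
by apply: eq_bigr => j _; rewrite !mxE.
Qed.

Lemma row_row_perm s v i : row i (row_perm s v) = row (s i) v.
Proof. by apply/rowP => j; rewrite !mxE. Qed.

Lemma transport_costE w v s :
  transport_cost w v s = dot (w - row_perm s v) (w - row_perm s v).
Proof.
rewrite dot_rows; apply: eq_bigr => i _.
by rewrite sqr_enorm linearB /= row_row_perm.
Qed.

Lemma W2sq_le w v s : W2sq w v <= dot (w - row_perm s v) (w - row_perm s v).
Proof. by rewrite /W2sq -transport_costE; case: arg_minP => // ? _; apply. Qed.

Lemma W2sq_optimal w v s : optimal_perm w v s ->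
  W2sq w v = dot (w - row_perm s v) (w - row_perm s v).
Proof.
by move=> s_opt; apply/le_anti; rewrite W2sq_le -transport_costE s_opt.
Qed.

Lemma W2sq_ge0 w v : 0 <= W2sq w v.
Proof. by rewrite /W2sq transport_costE dot_ge0. Qed.

Lemma exists_optimal_perm w v : exists s, optimal_perm w v s.
Proof.
by case: (@arg_minP _ R _ (1%g : 'S_n) xpredT (transport_cost w v)) => // s _ h;
  exists s => s'; exact: h.
Qed.

Lemma interpolationE w v s (t : R) :
  interpolation w v s t = w + t *: (row_perm s v - w).
Proof. by apply/matrixP => i j; rewrite !mxE; ring. Qed.

Lemma empirical_row_perm s v : empirical (row_perm s v) = empirical v.
Proof.
apply/funext => A; rewrite /empirical; congr (_ * _)%E.
rewrite [RHS](reindex_inj (@perm_inj _ s)).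
by apply: eq_bigr => i _; rewrite row_row_perm.
Qed.

Lemma particles_row_perm s v : particles (row_perm s v) = particles v.
Proof. by apply: eq_exist; apply: eq_measure; exact: empirical_row_perm. Qed.

End Transport.

(** * Descent inequalities, minimizers, gradient form of displacement convexity *)

Section SmoothFunctional.
Context {R : realType} {n d : nat}.
Variables (F : particle_measure R n d -> R) (l : R).
Hypothesis F_smooth : smooth F l.
Implicit Types (w v x u : 'M[R]_(n, d)) (s : 'S_n).
Local Notation f := (particle_fun F).
Local Notation g := (full_grad F).

Lemma particle_fun_row_perm s v : f (row_perm s v) = f v.
Proof. by rewrite /particle_fun particles_row_perm. Qed.

Lemma derive_particle_fun x u : 'D_u f x = dot (g x) u.
Proof.
have df := F_smooth.1 x; rewrite deriveE // {1}(matrix_sum_delta u) linear_sum.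
apply: eq_bigr => i _; rewrite linear_sum; apply: eq_bigr => j _.
by rewrite linearZ /= -deriveE // !mxE mulrC.
Qed.

Lemma is_derive_line x u (t : R) :
  is_derive t 1 (fun t => f (x + t *: u)) (dot (g (x + t *: u)) u).
Proof.
pose phi (t : R) := f (x + t *: u).
have lineE : (fun h : R => h^-1 *: ((phi \o shift t) (h *: 1) - phi t)) =
    (fun h => h^-1 *: ((f \o shift (x + t *: u)) (h *: u) - f (x + t *: u))).
  apply/funext => h /=; congr (_ *: (f _ - _)).
  have -> : h *: (1 : R) = h by exact: mulr1.
  by rewrite scalerDl addrCA.
have df : derivable f (x + t *: u) u by apply/diff_derivable/(F_smooth.1 _).
apply: DeriveDef.
  by rewrite /derivable lineE; exact: df.
by rewrite -derive_particle_fun /derive lineE.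
Qed.

Lemma sqr_grad_lipschitz w v :
  dot (g w - g v) (g w - g v) <= l ^+ 2 * dot (w - v) (w - v).
Proof.
rewrite -!sqr_enorm -exprMn ler_sqr ?nnegrE ?enorm_ge0 //.
  exact: F_smooth.2.
by apply: le_trans (F_smooth.2 w v); exact: enorm_ge0.
Qed.

Lemma normr_dot_grad_le w v u :
  `|dot (g w - g v) u| <= l * enorm (w - v) * enorm u.
Proof.
apply: (le_trans (normr_dot_le _ _)); apply: ler_wpM2r (F_smooth.2 w v).
exact: enorm_ge0.
Qed.

Lemma smooth_taylor w u : `|f (w + u) - f w - dot (g w) u| <= l / 2 * dot u u.
Proof.
have := @taylor1_dist _ (fun t => f (w + t *: u))
  (fun t => dot (g (w + t *: u)) u) (l * dot u u) (is_derive_line w u).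
rewrite scale1r scale0r addr0 mulrAC; apply=> t t_ge0.
rewrite -dotNl -dotDl; apply: (le_trans (normr_dot_grad_le _ _ _)).
rewrite addrC addKr -sqr_enorm /enorm !dotE mulrA -expr2 sqrtrM ?sqr_ge0 //.
by rewrite sqrtr_sqr ger0_norm // le_eqVlt; apply/orP; left; apply/eqP; ring.
Qed.

Lemma smooth_upper w u : f (w + u) <= f w + dot (g w) u + l / 2 * dot u u.
Proof. by have /ler_normlP[_] := smooth_taylor w u; lra. Qed.

Lemma smooth_lower w u : f w + dot (g w) u - l / 2 * dot u u <= f (w + u).
Proof. by have /ler_normlP[] := smooth_taylor w u; lra. Qed.

Lemma continuous_grad_line x u i j :
  continuous (fun t : R => g (x + t *: u) i j).
Proof.
apply: (@lipschitz_continuous _ _ (l * enorm u)) => s t.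
have -> : g (x + s *: u) i j - g (x + t *: u) i j =
          (g (x + s *: u) - g (x + t *: u)) i j by rewrite !mxE.
rewrite -sqrtr_sqr; apply: (le_trans (ler_wsqrtr (sqr_coef_le_dot _ i j))).
apply: (le_trans (F_smooth.2 _ _)).
have -> : x + s *: u - (x + t *: u) = (s - t) *: u.
  by rewrite opprD addrACA subrr add0r scalerBl.
rewrite /enorm !dotE mulrA -expr2 sqrtrM ?sqr_ge0 // sqrtr_sqr.
by rewrite le_eqVlt; apply/orP; left; apply/eqP; ring.
Qed.

Lemma smooth_ge0 : (0 < n)%N -> (0 < d)%N -> 0 <= l.
Proof.
move=> n_gt0 d_gt0.
have := F_smooth.2 (const_mx 1) 0; rewrite subr0.
have A_gt0 : 0 < enorm (const_mx 1 : 'M[R]_(n, d)).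
  rewrite sqrtr_gt0; apply: (@lt_le_trans _ _ 1) => //.
  have := sqr_coef_le_dot (const_mx 1 : 'M[R]_(n, d))
    (Ordinal n_gt0) (Ordinal d_gt0).
  by rewrite mxE expr1n.
move=> h; rewrite -(pmulr_lge0 _ A_gt0); exact: le_trans (enorm_ge0 _) h.
Qed.

Lemma gradient_step_decrease (gamma : R) w : 0 < gamma -> gamma <= 1 / l ->
  gamma / 2 * dot (g w) (g w) <= f w - f (w - gamma *: g w).
Proof.
move=> g_gt0 gl.
(* Since [1 / 0 = 0], the bound [0 < gamma <= 1 / l] also excludes [l = 0]. *)
have l_gt0 : 0 < l by rewrite -invr_gt0 -div1r (lt_le_trans g_gt0).
have := smooth_upper w (- gamma *: g w); rewrite scaleNr !dotE.
rewrite ler_pdivlMr // in gl.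
have : gamma * l * (gamma * dot (g w) (g w)) <= gamma * dot (g w) (g w).
  by rewrite ler_piMl // mulr_ge0 ?dot_ge0 // ltW.
lra.
Qed.

Section Minimizer.
Variable v : 'M[R]_(n, d).
Hypothesis v_min : is_minimizer F (particles v).

Lemma minimizer_le w : f v <= f w. Proof. exact: v_min. Qed.

(** A gradient step of length [tau], chosen so that [l * tau <= 1], would otherwise go below the
    minimum, which the relabelled [v] attains too. *)
Lemma grad_minimizer s : g (row_perm s v) = 0.
Proof.
apply: dot_eq0; apply/le_anti; rewrite dot_ge0 andbT.
set y := row_perm s v; set q := dot _ _.
pose tau := (`|l| + 1)^-1.
have tau_gt0 : 0 < tau by rewrite invr_gt0 ltr_wpDl.
have := smooth_upper y (- tau *: g y); rewrite !dotE.
have := minimizer_le (y + - tau *: g y).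
rewrite -(particle_fun_row_perm s v) -/y -/q.
have ltau : l * tau <= 1.
  by rewrite ler_pdivrMr ?ltr_wpDl // mul1r (le_trans (ler_norm l)) // lerDl.
move=> h1 h2; have : 0 <= (l * tau / 2 - 1) * (tau * q) by lra.
have : 0 <= tau * q by rewrite mulr_ge0 ?dot_ge0 ?ltW.
rewrite -(pmulr_rle0 _ tau_gt0); nra.
Qed.

(** The quadratic upper model at [row_perm s v], where the gradient vanishes; it turns distance
    decay into decay of [F] in (a). *)
Lemma suboptimality_le w s :
  f w - f v <= l / 2 * dot (w - row_perm s v) (w - row_perm s v).
Proof.
have := smooth_upper (row_perm s v) (w - row_perm s v).
rewrite grad_minimizer addrC subrK particle_fun_row_perm.
by rewrite dot0l; lra.
Qed.

End Minimizer.

(** Compare the interpolation bound with the lower Taylor model, divide by [t] and let [t] tend to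
    [0]. *)
Lemma displacement_convex_gradient (lambda : R) w v s :
    (forall t : R, 0 <= t <= 1 ->
       F (particles (interpolation w v s t)) <=
         (1 - t) * F (particles w) + t * F (particles v)
         - lambda / 2 * t * (1 - t) * W2sq w v) ->
  f w + dot (g w) (row_perm s v - w) + lambda / 2 * W2sq w v <= f v.
Proof.
move=> conv; set u := row_perm s v - w.
(* [t * C] is the error left after dividing by [t]: the Taylor remainder and the [t] in the factor
   [1 - t]. *)
pose C := l / 2 * dot u u + lambda / 2 * W2sq w v.
have small (t : R) : 0 < t <= 1 ->
    f w + dot (g w) u + lambda / 2 * W2sq w v <= f v + t * C.
  case/andP=> t_gt0 t_le1; have := smooth_lower w (t *: u).
  rewrite dotZr dotZl dotZr.
  have := conv t; rewrite interpolationE (ltW t_gt0) t_le1 -/u => /(_ isT).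
  rewrite -/(f w) -/(f v) -/(f (w + t *: u)) /C => h1 h2.
  rewrite -(ler_pM2l t_gt0); lra.
apply/ler_addgt0Pr => e e_gt0.
pose t := Num.min 1 (e / (`|C| + 1)).
have C_gt0 : 0 < `|C| + 1 by rewrite ltr_wpDl.
have t01 : 0 < t <= 1 by rewrite lt_min ltr01 divr_gt0 //= ge_min lexx.
apply: (le_trans (small t t01)); rewrite lerD2l.
have /andP[t_gt0 _] := t01; apply: (@le_trans _ _ (t * (`|C| + 1))).
  by rewrite ler_pM2l // (le_trans (ler_norm C)) // lerDl.
by rewrite -ler_pdivlMr // ge_min lexx orbT.
Qed.

End SmoothFunctional.

(** * Separation of particles: near a configuration, along segments, under perturbation *)

Section Gap.
Context {R : realType} {n d : nat}.
Implicit Types (w v p q : 'M[R]_(n, d)) (s : 'S_n).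

Definition row_separated (a : R) w : Prop :=
  forall i j, i != j -> a <= dot (row i w - row j w) (row i w - row j w).

Lemma injective_separated w :
  injective (fun i => row i w) -> exists2 a : R, 0 < a & row_separated a w.
Proof.
move=> w_inj; pose c (ij : 'I_n * 'I_n) :=
  dot (row ij.1 w - row ij.2 w) (row ij.1 w - row ij.2 w).
(* The default [1] keeps the minimum positive when there is no pair of distinct indices. *)
exists (\big[Order.min/1]_(ij : 'I_n * 'I_n | ij.1 != ij.2) c ij).
  apply/bigmin_gtP; split=> // -[i j] /= ij; rewrite lt_neqAle dot_ge0 andbT.
  apply: contra ij => /eqP/esym/dot_eq0/eqP; rewrite subr_eq0 => /eqP.
  by move/w_inj/eqP.
move=> i j ij.
exact: (@bigmin_le_cond _ _ _ 1 (i, j) (fun ij => ij.1 != ij.2) c ij).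
Qed.

(** If [s] moved [i], optimality against [1%g] would put row [s i] of [q] within [|q - p|] of row
    [i] of [p]; it is as close to row [s i] of [p], so these two rows of [p] would be too close. *)
Lemma optimal_perm_near (a : R) p q s : row_separated a p ->
  4 * dot (q - p) (q - p) < a -> optimal_perm p q s -> s = 1%g.
Proof.
move=> p_sep qp_lt s_opt; apply/permP => i; rewrite perm1; apply/eqP.
apply: contraLR qp_lt => si; rewrite -leNgt.
have := s_opt 1%g; rewrite !transport_costE row_perm1.
rewrite -[p - q]opprB !dotNl !dotNr.
rewrite opprK dot_rows (bigD1 i) //= linearB /= row_row_perm => cost_le.
have : 0 <= \sum_(k < n | k != i)
    dot (row k (p - row_perm s q)) (row k (p - row_perm s q)).
  by apply: sumr_ge0 => k _; exact: dot_ge0.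
have := p_sep i (s i); rewrite eq_sym si => /(_ isT).
have : dot (row (s i) (q - p)) (row (s i) (q - p)) <= dot (q - p) (q - p).
  rewrite (dot_rows (q - p)) (bigD1 (s i)) //= lerDl.
  by apply: sumr_ge0 => k _; exact: dot_ge0.
rewrite linearB /=; move: cost_le.
move: (row i p) (row (s i) p) (row (s i) q) => x y z.
(* The vector is [(x - z) + (y - z)], whence [|x - y|^2 <= 2 |x - z|^2 + 2 |y - z|^2]. *)
have := dot_ge0 (x - y + 2 *: (y - z)); rewrite !dotE.
rewrite (dotC y x) (dotC z x) (dotC z y); lra.
Qed.

(* Optimality against [tperm i j * s] is monotonicity of the transport. *)
Lemma optimal_perm_monotone p v s i j : optimal_perm p v s ->
  0 <= dot (row i p - row j p) (row i (row_perm s v) - row j (row_perm s v)).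
Proof.
move=> s_opt; have [->|ij] := eqVneq i j; first by rewrite subrr dot0l.
have := s_opt (tperm i j * s)%g; rewrite !transport_costE.
rewrite (dot_rows (p - row_perm s v)).
rewrite (dot_rows (p - row_perm (tperm i j * s) v)).
rewrite (bigD1 i) //= [in X in _ <= X](bigD1 i) //=.
rewrite (bigD1 j) 1?eq_sym //= [in X in _ <= X](bigD1 j) 1?eq_sym //=.
rewrite (eq_bigr (fun k => dot (row k (p - row_perm (tperm i j * s) v))
                               (row k (p - row_perm (tperm i j * s) v)))).
  rewrite !addrA lerD2r !linearB /= !row_row_perm !permM tpermL tpermR.
  move: (row i p) (row j p) (row (s i) v) (row (s j) v) => x y z t.
  rewrite !dotE (dotC z x) (dotC z y) (dotC t x) (dotC t y); lra.
move=> k /andP[ki kj]; rewrite !linearB /= !row_row_perm permM.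
by rewrite tpermD // eq_sym.
Qed.

(** In the squared difference of two rows the cross term is nonnegative by monotonicity, and
    [(1 - t)^2 + t^2 >= 1 / 2]. *)
Lemma separated_segment (a : R) p v s (t : R) : 0 <= t <= 1 -> 0 <= a ->
    row_separated a p -> row_separated a v -> optimal_perm p v s ->
  row_separated (a / 2) (p + t *: (row_perm s v - p)).
Proof.
move=> /andP[t_ge0 t_le1] a_ge0 p_sep v_sep s_opt i j ij.
have := optimal_perm_monotone i j s_opt; have := p_sep _ _ ij.
have := v_sep (s i) (s j); rewrite (inj_eq perm_inj) => /(_ ij).
have rowE k : row k (p + t *: (row_perm s v - p)) =
    row k p + t *: (row (s k) v - row k p) by apply/rowP => ?; rewrite !mxE.
rewrite !rowE !row_row_perm.
move: (row i p) (row j p) (row (s i) v) (row (s j) v) => x y z u h1 h2 h3.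
have -> : x + t *: (z - x) - (y + t *: (u - y)) =
    (1 - t) *: (x - y) + t *: (z - u).
  by apply/rowP => k; rewrite !mxE; ring.
rewrite dotDl !dotDr !dotZl !dotZr (dotC (z - u) (x - y)).
move: h1 h2 h3.
move: (dot (x - y) (x - y)) (dot (z - u) (z - u)) (dot (x - y) (z - u)).
move=> X Z Y h1 h2 h3; have := ler_wpM2l (sqr_ge0 (1 - t)) h2.
have := ler_wpM2l (sqr_ge0 t) h1.
have : 0 <= t * (1 - t) * Y by rewrite !mulr_ge0 // subr_ge0.
have := mulr_ge0 a_ge0 (sqr_ge0 (2 * t - 1)); lra.
Qed.

(** Row [i] moves at speed [i] in each coordinate, so two given rows meet for at most one [t]; there
    are finitely many pairs. *)
Lemma near_injective_line w : (0 < d)%N ->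
  \forall t \near dnbhs (0 : R),
    injective (fun i => row i (w + t *: \matrix_(i < n, j < d) (i%:R : R))).
Proof.
case: d w => // d' w _.
have pair_neq (ij : 'I_n * 'I_n) :
    \forall t \near dnbhs (0 : R), ij.1 != ij.2 ->
    row ij.1 (w + t *: \matrix_(i < n, j < d'.+1) (i%:R : R)) !=
    row ij.2 (w + t *: \matrix_(i < n, j < d'.+1) (i%:R : R)).
  case: ij => i j /=; have [_|ij] := eqVneq i j; first exact: nearW.
  have ij0 : (i%:R - j%:R : R) != 0 by rewrite subr_eq0 eqr_nat.
  pose t0 := - (w i ord0 - w j ord0) / (i%:R - j%:R).
  have : \forall t \near dnbhs (0 : R), t != t0.
    have [->|t00] := eqVneq t0 0; first exact: nbhs_dnbhs_neq.
    apply: nbhs_dnbhs; apply: open_nbhs_nbhs; split; first exact: open_neq.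
    by rewrite /= eq_sym.
  apply: filterS => t tt0 _; apply: contra tt0 => /eqP/rowP/(_ ord0).
  rewrite !mxE => h; apply/eqP; rewrite /t0.
  by apply: (mulIf ij0); rewrite divfK //; lra.
apply: filterS (filter_forall _ pair_neq) => t h i j eq_ij.
apply/eqP/negPn/negP => ij; have := h (i, j) ij.
by rewrite /= eq_ij eqxx.
Qed.

End Gap.

(* Uses [|A + a|^2 <= (1 + 1/N) |A|^2 + (1 + N) |a|^2]. *)
Lemma telescope_cocoercive (R : realType) (m p : nat) (G : nat -> 'M[R]_(m, p))
    (e : 'M[R]_(m, p)) (b c : R) (N : nat) :
    (forall k, (k < N)%N -> dot (G k.+1 - G k) (G k.+1 - G k) + c * dot e e <=
       b * dot (G k.+1 - G k) e) ->
  dot (G N - G 0%N) (G N - G 0%N) + c * N%:R ^+ 2 * dot e e <=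
    b * N%:R * dot (G N - G 0%N) e.
Proof.
elim: N => [_|N IH step].
  by rewrite subrr dot0l expr0n /= !(mulr0, mul0r) addr0.
have {}IH := IH (fun k kN => step k (ltnW kN)); have {step} := step N (ltnSn N).
have -> : G N.+1 - G 0%N = (G N - G 0%N) + (G N.+1 - G N).
  by rewrite [RHS]addrC addrA subrK.
move: IH; set A := G N - _; set a := G N.+1 - _ => IH.
have [N0|N_gt0] := posnP N.
  have -> : A = 0 by rewrite /A N0 subrr.
  by rewrite N0 add0r expr1n !mulr1.
have N_gt0R : 0 < N%:R :> R by rewrite ltr0n.
clearbody A a.
have := dot_ge0 (A - N%:R *: a); rewrite !dotE (dotC a A) -[N.+1%:R]natr1.
move: IH N_gt0R; move: (N%:R : R) => x h1 x0 h2 h3.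
rewrite -(ler_pM2l x0).
have x1 : 0 < x + 1 by rewrite addr_gt0.
have := ler_wpM2l (ltW x1) h1.
have := ler_wpM2l (mulr_ge0 (ltW x0) (ltW x1)) h3.
lra.
Qed.

(** * From local convexity to cocoercivity of the gradient *)

Section Cocoercivity.
Context {R : realType} {n d : nat}.
Variables (F : particle_measure R n d -> R) (l lambda : R).
Hypotheses (F_smooth : smooth F l) (l_ge0 : 0 <= l) (lambda_ge0 : 0 <= lambda).
Implicit Types (w v x y p q u : 'M[R]_(n, d)) (s : 'S_n).
Local Notation f := (particle_fun F).
Local Notation g := (full_grad F).

Definition convex_at p q : Prop :=
  f p + dot (g p) (q - p) + lambda / 2 * dot (q - p) (q - p) <= f q.

(* The interpolation inequality of strongly convex smooth functions. *)
Definition cocoercive_at x y : Prop :=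
  dot (g y - g x) (g y - g x) + lambda * l * dot (y - x) (y - x) <=
    (l + lambda) * dot (g y - g x) (y - x).

(* Compares the lower model at [x] with the upper model at [y] in the point
   where their difference is extremal. *)
Lemma cocoercive_half x y : lambda < l ->
    let D := g y - g x - lambda *: (y - x) in
    convex_at x (y - (l - lambda)^-1 *: D) ->
  f x - f y + dot (g x) (y - x) + lambda / 2 * dot (y - x) (y - x)
    + (2 * (l - lambda))^-1 * dot D D <= 0.
Proof.
move=> lam_lt D; set L := l - lambda.
have L_gt0 : 0 < L by rewrite subr_gt0.
rewrite /convex_at.
have := smooth_upper F_smooth y (- L^-1 *: D); rewrite scaleNr.
have -> : y - L^-1 *: D - x = (y - x) - L^-1 *: D by rewrite addrAC.
set u := y - x; set a := L^-1.
have gyE : g y = D + g x + lambda *: u by rewrite /D addrAC subrK subrK.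
rewrite {1}gyE -/u.
have -> : (2 * L)^-1 = a / 2 by rewrite invfM mulrC.
have lE : l = a^-1 + lambda by rewrite invrK subrK.
rewrite lE.
rewrite !(dotNr, dotNl, dotZr, dotZl, dotDl u, dotDr u,
  dotDl D, dotDl (D + g x)).
have a_neq0 : a != 0 by rewrite invr_neq0 // gt_eqF.
rewrite (dotC D u).
have -> : (a^-1 + lambda) / 2 * - - (a * (a * dot D D)) =
   a * dot D D / 2 + lambda / 2 * a ^+ 2 * dot D D by field.
lra.
Qed.

(** For [lambda < l], adding [cocoercive_half] at [(x, y)] and [(y, x)] cancels the values of [f].
    [K] limits how far from [x] and [y] convexity is invoked. *)
Lemma cocoercive_local : exists2 K : R, 0 < K & forall x y,
  (forall p q, p = x \/ p = y ->
    dot (q - p) (q - p) <= K * dot (y - x) (y - x) -> convex_at p q) ->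
  cocoercive_at x y.
Proof.
(* For [l <= lambda] there is no positive [l - lambda] to divide by; strong monotonicity and the
   Lipschitz bound suffice. *)
have [l_le|lam_lt] := leP l lambda.
  exists 1 => // x y conv; rewrite /cocoercive_at.
  have := conv x y (or_introl erefl); have := conv y x (or_intror erefl).
  rewrite /convex_at -[x - y]opprB !(dotNl, dotNr) opprK !mul1r lexx.
  move=> /(_ isT) h1 /(_ isT) h2; have h3 := sqr_grad_lipschitz F_smooth y x.
  have h4 : lambda * dot (y - x) (y - x) <= dot (g y - g x) (y - x).
    rewrite (dotDl (g y)) dotNl; lra.
  have llam : 0 <= l + lambda by rewrite addr_ge0.
  have := ler_wpM2l llam h4.
  have := ler_wpM2r (dot_ge0 (y - x)) (ler_wpM2l llam l_le); lra.
set L := l - lambda; have L_gt0 : 0 < L by rewrite subr_gt0.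
(* With [u = q - p] and [D = g q - g p - lambda u]: [|u - D / L|^2 <= 2 |u|^2 + 2 |D|^2 / L^2] and
   [|D|^2 <= 2 (l^2 + lambda^2) |u|^2]. *)
exists (2 + 4 * (l ^+ 2 + lambda ^+ 2) / L ^+ 2).
  by rewrite ltr_wpDr // !mulr_ge0 // ?invr_ge0 ?addr_ge0 ?sqr_ge0.
move=> x y conv.
have far p q : dot ((q - p) - L^-1 *: (g q - g p - lambda *: (q - p)))
                   ((q - p) - L^-1 *: (g q - g p - lambda *: (q - p))) <=
    (2 + 4 * (l ^+ 2 + lambda ^+ 2) / L ^+ 2) * dot (q - p) (q - p).
  have := sqr_grad_lipschitz F_smooth q p.
  move: (q - p) (g q - g p) => u G.
  have := dot_ge0 (u + L^-1 *: (G - lambda *: u)).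
  have := dot_ge0 (L^-1 *: (G + lambda *: u)).
  rewrite !dotE (dotC u G) -exprVn.
  move: (L^-1) => a.
  move=> h1 h2 h3; have := ler_wpM2l (sqr_ge0 a) h3; lra.
have h1 : convex_at x (y - L^-1 *: (g y - g x - lambda *: (y - x))).
  by apply: conv; [left|rewrite addrAC; exact: far].
have h2 : convex_at y (x - L^-1 *: (g x - g y - lambda *: (x - y))).
  apply: conv; [by right|rewrite addrAC -[y - x]opprB dotNl dotNr opprK].
  exact: far.
have {}h1 := cocoercive_half lam_lt h1; have := cocoercive_half lam_lt h2.
have -> : x - y = - (y - x) by rewrite opprB.
have -> : g x - g y = - (g y - g x) by rewrite opprB.
rewrite scalerN -opprD !(dotNl, dotNr) !opprK => {}h2; rewrite /cocoercive_at.
have GE := dotDl (g y) (- g x) (y - x); rewrite dotNl in GE; move: h1 h2 GE.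
rewrite -/L; move: (g y - g x) (y - x) => G u h1 h2 GE.
have : (2 * L)^-1 * (2 * dot (G - lambda *: u) (G - lambda *: u))
    <= dot G u - lambda * dot u u by lra.
rewrite ler_pdivrMl ?mulr_gt0 // !dotE (dotC u G) /L; lra.
Qed.

End Cocoercivity.

(** * Cocoercivity along optimal transport *)

Section OptimalCocoercivity.
Context {R : realType} {n d : nat}.
Variables (F : particle_measure R n d -> R) (l lambda : R).
Hypotheses (F_smooth : smooth F l) (l_ge0 : 0 <= l) (lambda_ge0 : 0 <= lambda).
Hypothesis F_conv : displacement_convex F lambda.
Implicit Types (w v x y p q u : 'M[R]_(n, d)) (s : 'S_n).
Local Notation f := (particle_fun F).
Local Notation g := (full_grad F).

(* Near a configuration of distinct particles the optimal permutation is the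
   identity, so displacement convexity is ordinary convexity there. *)
Lemma displacement_convex_near (a : R) p q : row_separated a p ->
  4 * dot (q - p) (q - p) < a -> convex_at F lambda p q.
Proof.
move=> p_sep qp; have [s s_opt conv] := F_conv p q.
have s1 := optimal_perm_near p_sep qp s_opt.
have := displacement_convex_gradient F_smooth conv.
rewrite (W2sq_optimal s_opt) s1 row_perm1 -[p - q]opprB dotNl dotNr opprK.
exact.
Qed.

(** The segment stays [a / 2]-separated, so on short pieces the convexity that [cocoercive_local]
    requires holds; [telescope_cocoercive] adds the pieces up. *)
Lemma cocoercive_separated (a : R) p v s : 0 < a ->
    row_separated a p -> row_separated a v -> optimal_perm p v s ->
  cocoercive_at F l lambda p (row_perm s v).
Proof.
move=> a_gt0 p_sep v_sep s_opt.
have [K K_gt0 coerc] := cocoercive_local F_smooth l_ge0 lambda_ge0.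
(* With this [B], [B < N <= N^2] gives [4 K |u|^2 / N^2 < a / 2]. *)
pose u := row_perm s v - p; pose B := 8 * K * dot u u / a.
have B_ge0 : 0 <= B by rewrite divr_ge0 ?mulr_ge0 ?dot_ge0 // ltW.
pose N := (Num.bound B).+1; pose h : R := N%:R^-1.
have N_gt0 : 0 < N%:R :> R by rewrite ltr0n.
have h_gt0 : 0 < h by rewrite invr_gt0.
have hN : h * N%:R = 1 by rewrite mulVf // gt_eqF.
have step_small : 4 * (K * dot (h *: u) (h *: u)) < a / 2.
  have BN : B < N%:R by rewrite (lt_trans (archi_boundP B_ge0)) // ltr_nat.
  rewrite ltr_pdivrMr // in BN; rewrite dotZl dotZr.
  have NN : N%:R <= N%:R * N%:R :> R by rewrite ler_peMr ?ler1n // ltW.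
  have {NN} := ler_wpM2r (ltW a_gt0) NN => /(lt_le_trans BN) {}BN.
  rewrite -(ltr_pM2l (mulr_gt0 h_gt0 h_gt0)) in BN.
  have hhNN : h * h * (N%:R * N%:R * a) = a.
    by rewrite mulrA mulrACA hN !mul1r.
  rewrite hhNN in BN; lra.
pose X (k : nat) := p + (k%:R * h) *: u.
have X_sep k : (k <= N)%N -> row_separated (a / 2) (X k).
  move=> kN; apply: separated_segment => //; last exact: ltW.
  by rewrite mulr_ge0 ?(ltW h_gt0) //= ler_pdivrMr // mul1r ler_nat.
have XS k : X k.+1 - X k = h *: u.
  by apply/matrixP => i j; rewrite !mxE -natr1; ring.
have X_coerc k : (k < N)%N ->
    dot (g (X k.+1) - g (X k)) (g (X k.+1) - g (X k))
      + lambda * l * dot (h *: u) (h *: u) <=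
    (l + lambda) * dot (g (X k.+1) - g (X k)) (h *: u).
  move=> kN; rewrite -(XS k); apply: coerc => x q xX; rewrite XS => qx.
  apply: (@displacement_convex_near (a / 2)).
    by case: xX => ->; apply: X_sep => //; exact: ltnW.
  by apply: le_lt_trans step_small; rewrite ler_pM2l.
have X0 : X 0%N = p by rewrite /X mul0r scale0r addr0.
have XN : X N = row_perm s v by rewrite /X mulrC hN scale1r addrC subrK.
have := telescope_cocoercive (G := g \o X) X_coerc.
rewrite /= X0 XN /cocoercive_at -/u.
rewrite 2!dotZr dotZl.
have -> : lambda * l * N%:R ^+ 2 * (h * (h * dot u u)) =
    (h * N%:R) ^+ 2 * (lambda * l * dot u u) by ring.
have -> : (l + lambda) * N%:R * (h * dot (g (row_perm s v) - g p) u) =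
    (h * N%:R) * ((l + lambda) * dot (g (row_perm s v) - g p) u) by ring.
by rewrite hN expr1n !mul1r.
Qed.

(* Both conditions are closed in [(p, v)] and hold for some [s] at the nearby
   configurations without coinciding particles. *)
Lemma optimal_cocoercive p v : (0 < d)%N ->
  exists2 s, optimal_perm p v s & cocoercive_at F l lambda p (row_perm s v).
Proof.
move=> d_gt0; apply: contrapT => noS.
pose P : 'M[R]_(n, d) := \matrix_(i < n, j < d) (i%:R : R).
have row_permP s t : row_perm s (v + t *: P) = row_perm s v + t *: row_perm s P.
  by apply/matrixP => i j; rewrite !mxE.
(* At [(p, v)] each [s] violates cocoercivity or optimality against some [s']. Violating a
   non-strict inequality is an open condition, so it persists for small [t]. *)
have bad s : \forall t \near dnbhs (0 : R),
    ~ (optimal_perm (p + t *: P) (v + t *: P) s /\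
       cocoercive_at F l lambda (p + t *: P) (row_perm s (v + t *: P))).
  have [s_opt|/existsNP[s' /negP]] := pselect (optimal_perm p v s).
    have {noS} : ~ cocoercive_at F l lambda p (row_perm s v).
      by move=> coerc; apply: noS; exists s.
    pose u t := (row_perm s v - p) + t *: (row_perm s P - P).
    pose G t := g (row_perm s v + t *: row_perm s P) - g (p + t *: P).
    pose H t := (l + lambda) * dot (G t) (u t) - (dot (G t) (G t) +
      lambda * l * dot (u t) (u t)).
    have HE t : (0 <= H t) =
        (dot (G t) (G t) + lambda * l * dot (u t) (u t) <=
         (l + lambda) * dot (G t) (u t)) by rewrite subr_ge0.
    have H0 : 0 <= H 0 -> cocoercive_at F l lambda p (row_perm s v).
      by rewrite HE /u /G !scale0r !addr0.
    move=> ncoerc; have {H0 ncoerc} : H 0 < 0.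
      by rewrite ltNge; apply/negP => /H0.
    have contG i j : {for 0, continuous (fun t => G t i j)}.
      rewrite (_ : (fun t => _) = (fun t =>
        g (row_perm s v + t *: row_perm s P) i j - g (p + t *: P) i j)).
        by apply: continuousB; exact: (continuous_grad_line F_smooth).
      by apply/funext => t; rewrite /G !mxE.
    have contu i j : {for 0, continuous (fun t => u t i j)}.
      exact: continuous_line.
    have contH : {for 0, continuous H}.
      apply: continuousB; last apply: continuousD.
      - by apply: continuousM; [exact: cst_continuous|exact: continuous_dot].
      - exact: continuous_dot.
      - by apply: continuousM; [exact: cst_continuous|exact: continuous_dot].
    move=> /(near_lt0 contH); apply: filterS => t Ht [_].
    rewrite /cocoercive_at row_permP; move: Ht; rewrite ltNge HE => /negP.
    rewrite -/(G t) (_ : _ - (p + t *: P) = u t) //.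
    by rewrite /u scalerBr addrACA -opprD.
  rewrite -ltNge -subr_lt0 => s'_lt.
  pose c s t := dot (p + t *: P - row_perm s (v + t *: P))
                    (p + t *: P - row_perm s (v + t *: P)).
  have contc s1 : {for 0, continuous (c s1)}.
    have contd i j : {for 0,
        continuous (fun t : R => (p + t *: P - row_perm s1 (v + t *: P)) i j)}.
      rewrite (_ : (fun t => _) = (fun t =>
        ((p - row_perm s1 v) + t *: (P - row_perm s1 P)) i j)).
        exact: continuous_line.
      by apply/funext => t; rewrite !mxE; ring.
    exact: continuous_dot.
  have c0 : c s' 0 - c s 0 < 0.
    by move: s'_lt; rewrite !transport_costE /c scale0r !addr0.
  have := near_lt0 (continuousB (contc s') (contc s)) c0; apply: filterS => t.
  rewrite subr_lt0 ltNge => /negP ct [/(_ s')].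
  by rewrite !transport_costE.
(* As there are finitely many permutations, one [t] serves them all and also separates the
   particles; an optimal permutation at this [t] gives the contradiction. *)
have /filter_ex[t [/injective_separated[a a_gt0 p_sep]]] :
    \forall t \near dnbhs (0 : R),
      injective (fun i => row i (p + t *: P)) /\
      injective (fun i => row i (v + t *: P)) /\
      forall s, ~ (optimal_perm (p + t *: P) (v + t *: P) s /\
        cocoercive_at F l lambda (p + t *: P) (row_perm s (v + t *: P))).
  apply: filterI; first exact: near_injective_line.
  by apply: filterI; [exact: near_injective_line|exact: (filter_forall _ bad)].
case=> /injective_separated[b b_gt0 v_sep] noS'.
have [s s_opt] := exists_optimal_perm (p + t *: P) (v + t *: P).
apply: (noS' s); split=> //; apply: (@cocoercive_separated (Num.min a b)) => //.
- by rewrite lt_min a_gt0.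
- by move=> i j ij; rewrite (le_trans _ (p_sep i j ij)) // ge_min lexx.
- by move=> i j ij; rewrite (le_trans _ (v_sep i j ij)) // ge_min lexx orbT.
Qed.

End OptimalCocoercivity.

(** * One step of gradient descent *)

Section GradientDescent.
Context {R : realType} {n d : nat}.
Variables (F : particle_measure R n d -> R) (l : R) (v : 'M[R]_(n, d)).
Hypotheses (F_smooth : smooth F l) (v_min : is_minimizer F (particles v)).
Variable gamma : R.
Hypothesis gamma_gt0 : 0 < gamma.
Implicit Types (w : 'M[R]_(n, d)) (s : 'S_n).
Local Notation f := (particle_fun F).
Local Notation g := (full_grad F).

Lemma dot_gradient_step w s :
  dot (w - gamma *: g w - row_perm s v) (w - gamma *: g w - row_perm s v) =
  dot (w - row_perm s v) (w - row_perm s v)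
    - 2 * gamma * dot (g w) (w - row_perm s v) + gamma ^+ 2 * dot (g w) (g w).
Proof.
rewrite addrAC; move: (w - row_perm s v) (g w) => u G.
by rewrite !dotE (dotC u G); ring.
Qed.

(** An optimal [s] for [w] serves as competitor for the next iterate. Cocoercivity, with zero
    gradient at [row_perm s v], bounds the cross term; the bound on [gamma] makes the leftover
    multiple of [|g w|^2] nonpositive. *)
Lemma W2sq_contraction (lambda : R) w : (0 < d)%N -> 0 <= l -> 0 < lambda ->
    displacement_convex F lambda -> gamma <= 2 / (lambda + l) ->
  W2sq (w - gamma *: g w) v <=
    (1 - 2 * lambda * l * gamma / (l + lambda)) * W2sq w v.
Proof.
move=> d_gt0 l_ge0 lam_gt0 F_conv gamma_le.
have [s s_opt] :=
  optimal_cocoercive F_smooth l_ge0 (ltW lam_gt0) F_conv w v d_gt0.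
rewrite /cocoercive_at (grad_minimizer F_smooth v_min) sub0r dotNl !dotNr opprK.
have -> : row_perm s v - w = - (w - row_perm s v) by rewrite opprB.
rewrite !(dotNl, dotNr) !opprK => coerc.
apply: (le_trans (W2sq_le _ _ s)).
rewrite dot_gradient_step (W2sq_optimal s_opt).
move: coerc (dot_ge0 (g w)); move: (w - row_perm s v) (g w) => u G coerc G_ge0.
have lam_l : 0 < l + lambda by rewrite ltr_wpDl.
rewrite [lambda + l]addrC ler_pdivlMr // in gamma_le.
rewrite -(ler_pM2l lam_l).
have -> :
    (l + lambda) * ((1 - 2 * lambda * l * gamma / (l + lambda)) * dot u u) =
    (l + lambda) * dot u u - 2 * gamma * (lambda * l * dot u u).
  by field; rewrite gt_eqF.
have := ler_wpM2l (ltW gamma_gt0) coerc.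
have := ler_wpM2r (mulr_ge0 (ltW gamma_gt0) G_ge0) gamma_le.
lra.
Qed.

(** The inner product with the gradient is at least [f w - f v], hence at least
    [gamma / 2 * |g w|^2] by descent, which absorbs the quadratic term. *)
Lemma W2sq_step_le w s : gamma <= 1 / l -> optimal_perm w v s ->
    f w - f v <= dot (w - row_perm s v) (g w) ->
  W2sq (w - gamma *: g w) v <= W2sq w v.
Proof.
move=> gl s_opt star; apply: (le_trans (W2sq_le _ _ s)).
rewrite dot_gradient_step (W2sq_optimal s_opt).
have h1 := gradient_step_decrease F_smooth w gamma_gt0 gl.
have h2 := minimizer_le v_min (w - gamma *: g w).
have : 0 <=
    gamma * (dot (g w) (w - row_perm s v) - gamma / 2 * dot (g w) (g w)).
  by rewrite mulr_ge0 ?(ltW gamma_gt0) // subr_ge0 dotC; lra.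
lra.
Qed.

(** Cauchy-Schwarz gives [(f w - f v)^2 <= W2sq w v * |g w|^2], and [gamma * |g w|^2] is at most
    twice the decrease. *)
Lemma suboptimality_step w s : gamma <= 1 / l -> optimal_perm w v s ->
    f w - f v <= dot (w - row_perm s v) (g w) ->
  gamma * (f w - f v) ^+ 2 <= 2 * W2sq w v * (f w - f (w - gamma *: g w)).
Proof.
move=> gl s_opt star; have h := gradient_step_decrease F_smooth w gamma_gt0 gl.
have e_ge0 : 0 <= f w - f v by rewrite subr_ge0 minimizer_le.
have {star} : (f w - f v) ^+ 2 <= W2sq w v * dot (g w) (g w).
  rewrite (W2sq_optimal s_opt); apply: le_trans (dot_CauchySchwarz _ _).
  by rewrite ler_sqr ?nnegrE // (le_trans e_ge0).
move=> /(ler_wpM2l (ltW gamma_gt0)); have := ler_wpM2l (W2sq_ge0 w v) h; lra.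
Qed.

Lemma star_displacement_convexE w s :
  \sum_(i < n) dot (row i w - row (s i) v) (particle_grad F i w) =
  dot (w - row_perm s v) (g w).
Proof.
rewrite dot_rows; apply: eq_bigr => i _.
by rewrite linearB /= row_row_perm rowK.
Qed.

(** Lets (b) share the argument of (c). *)
Lemma displacement_convex_star :
  displacement_convex F 0 -> star_displacement_convex F v.
Proof.
move=> F_conv w; have [s s_opt conv] := F_conv w v; exists s => //.
have := displacement_convex_gradient F_smooth conv.
rewrite star_displacement_convexE -(opprB w) dotNr dotC !mul0r addr0.
rewrite /particle_fun; lra.
Qed.

(** * Rates along the iterates *)

Section Iterates.
Variable w : nat -> 'M[R]_(n, d).
Hypothesis w_step : forall k, w k.+1 = w k - gamma *: g (w k).

Lemma linear_rate (lambda : R) (k : nat) : (0 < d)%N -> 0 <= l -> 0 < lambda ->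
    displacement_convex F lambda -> gamma <= 2 / (lambda + l) ->
  f (w k.+1) - f v <=
    l * (1 - 2 * lambda * l * gamma / (l + lambda)) ^+ k * W2sq (w 0%N) v.
Proof.
move=> d_gt0 l_ge0 lam_gt0 F_conv gamma_le.
set q := 1 - _.
have lam_l : 0 < l + lambda by rewrite ltr_wpDl.
have q_le1 : q <= 1.
  rewrite /q gerBl divr_ge0 ?(ltW lam_l) // !mulr_ge0 ?(ltW lam_gt0) //.
  exact: ltW.
(* From [gamma <= 2 / (l + lambda)] and [4 l lambda <= (l + lambda)^2]; this sign permits iterating
   the contraction. *)
have q_ge0 : 0 <= q.
  rewrite addrC in gamma_le; rewrite ler_pdivlMr // in gamma_le.
  rewrite subr_ge0 ler_pdivrMr // mul1r -(ler_pM2r lam_l).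
  have := ler_wpM2l (mulr_ge0 (ltW lam_gt0) l_ge0) gamma_le.
  have := sqr_ge0 (l - lambda); lra.
have W2_le m : W2sq (w m) v <= q ^+ m * W2sq (w 0%N) v.
  elim: m => [|m IH]; first by rewrite expr0 mul1r.
  rewrite w_step exprS -mulrA.
  apply: (le_trans (W2sq_contraction _ d_gt0 l_ge0 lam_gt0 F_conv gamma_le)).
  by rewrite ler_wpM2l.
have [s s_opt] := exists_optimal_perm (w k.+1) v.
have := suboptimality_le F_smooth v_min (w k.+1) s.
rewrite -(W2sq_optimal s_opt) => /le_trans; apply.
(* One of the [k.+1] factors [q] is dropped, as [q <= 1]. *)
have Wk : W2sq (w k.+1) v <= q ^+ k * W2sq (w 0%N) v.
  apply: (le_trans (W2_le _)); rewrite ler_wpM2r ?W2sq_ge0 //.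
  by rewrite exprS ler_piMl ?exprn_ge0.
apply: (@le_trans _ _ (l * W2sq (w k.+1) v)); last by rewrite -mulrA ler_wpM2l.
by rewrite ler_wpM2r ?W2sq_ge0 // ler_pdivrMr // ler_peMr // ler1n.
Qed.

(** [D] is [W2sq (w 0%N) v] in (b) and [r ^+ 2] in (c); the condition on [D = 0] secures the bound
    when it degenerates to [0]. *)
Lemma star_rate (D : R) (k : nat) : gamma <= 1 / l ->
    star_displacement_convex F v -> 0 <= D ->
    (D = 0 -> (0 < k)%N \/ f (w 0%N) - f v = 0) ->
    (forall m, (1 <= m <= k)%N -> W2sq (w m) v <= D) ->
  f (w k.+1) - f v <=
    2 * (f (w 0%N) - f v) * D / (2 * D + (f (w 0%N) - f v) * gamma * k%:R).
Proof.
move=> gl F_star D_ge0 D0 W_le.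
have dec m : f (w m.+1) <= f (w m).
  rewrite w_step -subr_ge0.
  apply: le_trans (gradient_step_decrease F_smooth _ gamma_gt0 gl).
  by rewrite mulr_ge0 ?dot_ge0 // divr_ge0 // ltW.
apply: (sublinear_rate (e := fun m => f (w m) - f v)) => //.
- by move=> m; rewrite subr_ge0 minimizer_le.
- by move=> m; rewrite lerD2r.
move=> m /W_le {}W_le; have [s s_opt] := F_star (w m).
rewrite star_displacement_convexE => /(suboptimality_step gl s_opt)/le_trans.
apply; rewrite -w_step opprB addrA subrK ler_wpM2r ?subr_ge0 //.
by rewrite ler_pM2l.
Qed.

Lemma W2sq_iterates_le m : gamma <= 1 / l -> star_displacement_convex F v ->
  W2sq (w m) v <= W2sq (w 0%N) v.
Proof.
move=> gl F_star; elim: m => [|m IH]; first exact: lexx.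
apply: le_trans IH; rewrite w_step.
have [s s_opt] := F_star (w m); rewrite star_displacement_convexE.
exact: W2sq_step_le.
Qed.

End Iterates.
End GradientDescent.

Unset Implicit Arguments.
Set Strict Implicit.
Set Printing Implicit Defensive.

Theorem theorem4p1 (R : realType) (n d : nat) (n_gt0 : (0 < n)%N)
    (d_gt0 : (0 < d)%N) (F : particle_measure R n d -> R) (l : R)
    (F_smooth : smooth F l)
    (v : 'M[R]_(n, d)) (v_min : is_minimizer F (particles v))
    (w : nat -> 'M[R]_(n, d)) (gamma : R) (gamma_gt0 : 0 < gamma)
    (w0_distinct : injective (fun i : 'I_n => row i (w 0%N)))
    (w_step : forall (k : nat) (i : 'I_n),
       row i (w k.+1) = row i (w k) - gamma *: particle_grad F i (w k)) :
  forall k : nat,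
  [/\ forall lambda : R, 0 < lambda -> displacement_convex F lambda ->
        gamma <= 2 / (lambda + l) ->
        F (particles (w k.+1)) - F (particles v) <=
          l * (1 - 2 * lambda * l * gamma / (l + lambda)) ^+ k
            * W2sq (w 0%N) v,
      displacement_convex F 0 -> gamma <= 1 / l ->
        F (particles (w k.+1)) - F (particles v) <=
          2 * (F (particles (w 0%N)) - F (particles v)) * W2sq (w 0%N) v /
          (2 * W2sq (w 0%N) v
             + (F (particles (w 0%N)) - F (particles v)) * gamma * k%:R)
    & forall r : R, star_displacement_convex F v ->
        (forall m : nat, (1 <= m <= k)%N -> W2sq (w m) v <= r ^+ 2) ->
        (* for k = 0 and r = 0 the bound below is the undefined 0/0 *)
        (k = 0%N -> r <> 0) ->
        gamma <= 1 / l ->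
        F (particles (w k.+1)) - F (particles v) <=
          2 * (F (particles (w 0%N)) - F (particles v)) * r ^+ 2 /
          (2 * r ^+ 2
             + (F (particles (w 0%N)) - F (particles v)) * gamma * k%:R)].
Proof.
move=> k.
have w_full m : w m.+1 = w m - gamma *: full_grad F (w m).
  by apply/matrixP => i j; have /rowP/(_ j) := w_step m i; rewrite !mxE.
have l_ge0 := smooth_ge0 F_smooth n_gt0 d_gt0.
split=> [lambda lam_gt0 F_conv gamma_le|F_conv gl|r F_star W_le r_neq0 gl].
- exact: (linear_rate F_smooth v_min gamma_gt0 w_full).
- have F_star := displacement_convex_star v F_smooth F_conv.
  apply: (star_rate F_smooth v_min gamma_gt0 w_full gl F_star (W2sq_ge0 _ _)).
    (* At distance zero the initial point already attains the minimum, which settles the degenerate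
       case even for [k = 0]. *)
    move=> W0; right; apply/le_anti; rewrite subr_ge0 minimizer_le // andbT.
    have [s s_opt] := exists_optimal_perm (w 0%N) v.
    have := suboptimality_le F_smooth v_min (w 0%N) s.
    by rewrite -(W2sq_optimal s_opt) W0 mulr0.
  by move=> m _; exact: (W2sq_iterates_le F_smooth v_min gamma_gt0 w_full).
- apply: (star_rate F_smooth v_min gamma_gt0 w_full gl F_star (sqr_ge0 r))
    => //.
  move=> /eqP; rewrite sqrf_eq0 => /eqP r0; left.
  by rewrite lt0n; apply/eqP => /r_neq0; exact.
Qed.
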